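(* Let $m\in\mathbb{N}$ with $m\ge 2$. Let $X_1,\dots,X_m,Y$ be independent with $X_i\sim\mathrm{Po}(\lambda_i)$ for $i=1,\dots,m$ and $Y\sim \mathrm{Po}\big(\sum_{i=1}^m\lambda_i\big)$, where $\lambda=(\lambda_1,\dots,\lambda_m)\in(0,\infty)^m$ is unknown, and consider estimation of $\lambda$ under the loss $L(d,\lambda)=\sum_{i=1}^m (d_i-\lambda_i)^2/\lambda_i$. Put $X=(X_1,\dots,X_m)$, $X_\cdot=\sum_{i=1}^m X_i$ and $$\hat\lambda(X)=X_\cdot\,\frac{X}{X_\cdot+m-1},\qquad \hat\lambda(X,Y)=\frac{X_\cdot+Y}{2}\,\frac{X}{X_\cdot+m-1}.$$ Then $\hat\lambda(X)$ is dominated by $\hat\lambda(X,Y)$.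
   Context: $\mathrm{Po}(\mu)$ is the Poisson distribution with mean $\mu$. The risk of an estimator $\delta$ at $\lambda$ is $E_\lambda[L(\delta,\lambda)]$. An estimator $\delta$ is dominated by $\delta'$ if the risk of $\delta'$ is at most the risk of $\delta$ for every $\lambda\in(0,\infty)^m$, with strict inequality for at least one $\lambda$. *)

(* Defs.v *)
From mathcomp Require Import all_boot all_order all_algebra.
From mathcomp Require Import all_classical all_reals all_analysis.

Set Implicit Arguments.
Unset Strict Implicit.
Unset Printing Implicit Defensive.

Import Order.TTheory GRing.Theory Num.Theory.
Import numFieldNormedType.Exports.

Local Open Scope classical_set_scope.
Local Open Scope ring_scope.

(* Mutual independence of a finite family of random variables. *)
Definition independent_RVs d d' (T : measurableType d) (T' : measurableType d')
    (R : realType) (P : probability T R) (I : finType)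
    (Z : I -> {mfun T >-> T'}) : Prop :=
  forall (J : {set I}) (A : I -> set T'),
    (forall i, i \in J -> measurable (A i)) ->
    P [set w | forall i, i \in J -> A i (Z i w)] =
    (\prod_(i in J) P (Z i @^-1` A i))%E.

(* The second argument of [poisson_prob] plays no role in its definition.
   Every subset of [nat] is measurable. *)
Definition has_poisson_law d (T : measurableType d) (R : realType)
    (P : probability T R) (Z : {mfun T >-> nat}) (mu : R) : Prop :=
  forall A : set nat, distribution P Z A = poisson_prob mu 0%N A.

(* The joint family X_1, ..., X_m, Y, with [None] indexing Y. *)
Definition joint_family d (T : measurableType d) (m : nat)
    (X : 'I_m -> {mfun T >-> nat}) (Y : {mfun T >-> nat})
    (i : option 'I_m) : {mfun T >-> nat} :=
  if i is Some j then X j else Y.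

Definition positive_vector (R : realType) (m : nat) (l : 'rV[R]_m) : Prop :=
  forall i, 0 < l 0 i.

Definition loss (R : realType) (m : nat) (a l : 'rV[R]_m) : R :=
  \sum_(i < m) (a 0 i - l 0 i) ^+ 2 / l 0 i.

(* An estimator is a function of the observations (x_1, ..., x_m) and y. *)
Definition estimator (R : realType) (m : nat) : Type :=
  ('I_m -> nat) -> nat -> 'rV[R]_m.

Definition risk d (T : measurableType d) (R : realType) (m : nat)
    (P : 'rV[R]_m -> probability T R)
    (X : 'I_m -> {mfun T >-> nat}) (Y : {mfun T >-> nat})
    (delta : estimator R m) (l : 'rV[R]_m) : \bar R :=
  ('E_(P l)[fun w => loss (delta (fun i => X i w) (Y w)) l])%E.

Definition estimator_dominated_by d (T : measurableType d) (R : realType) (m : nat)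
    (P : 'rV[R]_m -> probability T R)
    (X : 'I_m -> {mfun T >-> nat}) (Y : {mfun T >-> nat})
    (delta delta' : estimator R m) : Prop :=
  (forall l, positive_vector l ->
     (risk P X Y delta' l <= risk P X Y delta l)%E) /\
  (exists l, positive_vector l /\
     (risk P X Y delta' l < risk P X Y delta l)%E).

Definition total_count (m : nat) (x : 'I_m -> nat) : nat := (\sum_(i < m) x i)%N.

Definition lambda_hat_X (R : realType) (m : nat) : estimator R m :=
  fun x _ => \row_(i < m)
    ((total_count x)%:R * ((x i)%:R / ((total_count x)%:R + m%:R - 1))).

Definition lambda_hat_XY (R : realType) (m : nat) : estimator R m :=
  fun x y => \row_(i < m)
    (((total_count x)%:R + y%:R) / 2 * ((x i)%:R / ((total_count x)%:R + m%:R - 1))).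

(* Main.v *)
(* Write N for the total of X, k = m - 1, Lambda for the sum of the lambda_i
   and c(N) = 1 / (N + k). For independent Poisson counts Z_i of mean mu_i,
   Stein's identity E[Z_i G(Z)] = mu_i E[G(Z + e_i)] lets one replace, without
   changing expectations, the difference of the two losses by a function of N
   only: the terms X_i^2 / lambda_i lose their denominators, and Lambda and Y
   are eliminated by trading Y h(N) for Lambda h(N) and the latter for
   N h(N - 1). With f(N) = N c(N) the outcome is
     (3 f(N + 1) - f(N) + 3 N (f(N + 1) - 2 f(N) + f(N - 1))) / 4,
   which is positive for every N >= 0 and k >= 1. Hence the improvement is
   strict at every lambda. *)

Require Import Defs.
From mathcomp Require Import all_boot all_order all_algebra.
From mathcomp Require Import all_classical all_reals all_analysis.
From mathcomp Require Import measurable_realfun ring lra.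

Set Implicit Arguments.
Unset Strict Implicit.
Unset Printing Implicit Defensive.

Import Order.TTheory GRing.Theory Num.Theory.
Import numFieldNormedType.Exports.

Local Open Scope classical_set_scope.
Local Open Scope ring_scope.

(** * Expectations of functions of a countable-valued map, as sums over its values *)

Section discrete.
Context d (T : measurableType d) (R : realType) (U : countType) (V : T -> U).
Hypothesis mV : forall u, measurable (V @^-1` [set u]).

Lemma measurable_preimage_countable (A : set U) : measurable (V @^-1` A).
Proof.
have -> : V @^-1` A = \bigcup_u (if u \in A then V @^-1` [set u] else set0).
  apply/seteqP; split=> [w Aw|w [u _]].
    by exists (V w) => //; rewrite mem_set.
  by case: ifPn => // /set_mem Au /= ->.
by apply: countable_bigcupT_measurable => // u; case: ifPn.
Qed.

Lemma measurable_fun_countable (f : U -> R) :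
  measurable_fun setT (EFin \o f \o V).
Proof.
move=> _ A _; rewrite setTI comp_preimage.
exact: measurable_preimage_countable.
Qed.

(** The space is cut into the fibres of [pickle \o V], on each of which the integrand is constant.
    The resulting series over [nat] is reindexed along [pickle]; numbers that code no element have
    an empty fibre and contribute [0]. *)
Lemma integral_countable (P : probability T R) (f : U -> R) :
  (forall u, 0 <= f u) ->
  (\int[P]_w (f (V w))%:E = \esum_(u in setT) ((f u)%:E * P (V @^-1` [set u])))%E.
Proof.
move=> f0.
pose h u := ((f u)%:E * P (V @^-1` [set u]))%E.
have h0 u : (0 <= h u)%E by rewrite mule_ge0// lee_fin.
pose F n := V @^-1` (pickle @^-1` [set n]).
have mf := measurable_fun_countable f.
have TF : [set: T] = \bigcup_n F n.
  by apply/seteqP; split=> // w _; exists (pickle (V w)).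
rewrite [X in (\int[_]_(_ in X) _)%E]TF ge0_integral_bigcup//=; first last.
- apply/trivIsetP => i j _ _ /eqP ij; apply/seteqP; split=> // w [/= wi wj].
  by apply: ij; rewrite -wi -wj.
- by move=> w _; rewrite lee_fin.
- by rewrite -TF.
- by move=> n; exact: measurable_preimage_countable.
have FE n : (\int[P]_(w in F n) (f (V w))%:E =
    if (pickle_inv n : option U) is Some u then h u else 0)%E.
  have := @pickle_invK U n; case pE: (pickle_inv n : option U) => [u|] /= uE.
    have FnE : F n = V @^-1` [set u].
      apply/seteqP; split=> w /=; last by rewrite /F /= => ->.
      by rewrite /F /= -uE => /(pcan_inj pickleK).
    rewrite FnE (eq_integral (fun=> (f u)%:E)); last by move=> w /[!inE] /= ->.
    by rewrite integral_cst.
  have FnE : F n = set0.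
    apply/seteqP; split=> // w /=; rewrite /F /= => wn.
    by move: pE; rewrite -wn pickleK_inv.
  by rewrite FnE integral_set0.
under eq_eseriesr do rewrite FE.
rewrite nneseries_esumT; last by move=> n; case: pickle_inv.
rewrite -/h.
have pickle_bij : set_bij [set: U] (range (@pickle U)) (@pickle U).
  split=> [u _|u v _ _ /(pcan_inj pickleK)//|n [u _ <-]]; by exists u.
transitivity (\esum_(n in range (@pickle U))
    (if (pickle_inv n : option U) is Some u then h u else 0))%E.
  rewrite [RHS]esum_mkcond; apply: eq_esum => n _.
  case: ifPn => // /negP; have := @pickle_invK U n.
  case: ((pickle_inv n : option U)) => [u /= uE|//] []; apply/mem_set; by exists u.
rewrite (reindex_esum _ _ _ _ pickle_bij).
by apply: eq_esum => u _; rewrite pickleK_inv.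
Qed.
End discrete.

(** * Stein's identity and integrability for independent Poisson counts *)

Section poisson_family.
Context d (T : measurableType d) (R : realType) (P : probability T R).
Context (I : finType) (Z : I -> {mfun T >-> nat}) (mu : I -> R).
Hypothesis mu_gt0 : forall i, 0 < mu i.
Hypothesis Z_poisson : forall i, has_poisson_law P (Z i) (mu i).
Hypothesis Z_indep : independent_RVs P Z.

Implicit Types (u : {ffun I -> nat}) (F G : {ffun I -> nat} -> R).

Definition counts (w : T) : {ffun I -> nat} := [ffun i => Z i w].

(** The shift Z + e_i of Stein's identity. *)
Definition incr (i : I) u : {ffun I -> nat} := [ffun j => (u j + (j == i))%N].

Definition mean F : \bar R := (\int[P]_w (F (counts w))%:E)%E.

Definition has_mean F : Prop :=
  P.-integrable setT (fun w => (F (counts w))%:E).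

Lemma counts_preimage u :
  counts @^-1` [set u] = [set w | forall i, i \in [set: I]%SET -> [set u i] (Z i w)].
Proof.
apply/seteqP; split=> w /=.
  by move=> <- i _; rewrite ffunE.
by move=> Zu; apply/ffunP => i; rewrite ffunE Zu// inE.
Qed.

Lemma measurable_counts u : measurable (counts @^-1` [set u]).
Proof.
have -> : counts @^-1` [set u] = \bigcap_(i in [set: I]) (Z i @^-1` [set u i]).
  rewrite counts_preimage; apply/seteqP; split=> w /= h i; first by move=> _; apply: h; rewrite inE.
  by move=> _; exact: h.
apply: fin_bigcap_measurable => // i _.
by rewrite -[X in measurable X]setTI; exact: measurable_funP.
Qed.

Lemma counts_pmf u :
  P (counts @^-1` [set u]) = (\prod_i poisson_pmf (mu i) (u i))%:E.
Proof.
rewrite counts_preimage (Z_indep (J := [set: I]%SET) (A := fun i => [set u i]))// -prodEFin.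
rewrite (eq_bigl xpredT); last by move=> i; rewrite inE.
apply: eq_bigr => i _; have := Z_poisson i [set u i].
by rewrite /poisson_prob mu_gt0 esum_set1// lee_fin poisson_pmf_ge0.
Qed.

Lemma incr_inj i : injective (incr i).
Proof.
move=> u v /ffunP uv; apply/ffunP => j; have := uv j; rewrite !ffunE.
exact: addIn.
Qed.

Lemma poisson_pmfS (r : R) k : 0 < r ->
  k.+1%:R * poisson_pmf r k.+1 = r * poisson_pmf r k.
Proof.
move=> r0; rewrite /poisson_pmf r0 factS natrM exprS invfM.
have k0 : k.+1%:R != 0 :> R by rewrite pnatr_eq0.
have f0 : k`!%:R != 0 :> R by rewrite pnatr_eq0 -lt0n fact_gt0.
by move: k0 f0; move: (k.+1%:R : R) (k`!%:R : R) => a b a0 b0; field; rewrite a0 b0.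
Qed.

Lemma prod_pmf_incr i u :
  (incr i u i)%:R * \prod_j poisson_pmf (mu j) (incr i u j) =
  mu i * \prod_j poisson_pmf (mu j) (u j).
Proof.
rewrite (bigD1 i)//= [in RHS](bigD1 i)//= !mulrA ffunE eqxx addn1 poisson_pmfS//.
congr *%R; apply: eq_bigr => j ji; by rewrite ffunE (negbTE ji) addn0.
Qed.

Lemma measurable_counts_comp F : measurable_fun setT (EFin \o F \o counts).
Proof. exact: measurable_fun_countable measurable_counts F. Qed.

(** Stein's identity, valid here even when both sides are infinite. Both means become sums over
    count vectors: the factor [u i] kills the vectors outside the range of [incr i], and on that
    range [prod_pmf_incr] trades it for [mu i]. *)
Lemma ge0_mean_incr i G : (forall u, 0 <= G u) ->
  mean (fun u => (u i)%:R * G u) = ((mu i)%:E * mean (fun u => G (incr i u)))%E.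
Proof.
move=> G0; rewrite /mean -ge0_integralZl//=; first last.
- by rewrite lee_fin ltW.
- by move=> w _; rewrite lee_fin.
- exact: (measurable_counts_comp (fun u => G (incr i u))).
under [RHS]eq_integral do rewrite -EFinM.
rewrite (integral_countable measurable_counts P (f := fun u => (u i)%:R * G u)); last first.
  by move=> u; rewrite mulr_ge0.
rewrite (integral_countable measurable_counts P (f := fun u => mu i * G (incr i u))); last first.
  by move=> u; rewrite mulr_ge0// ltW.
have incr_bij : set_bij [set: {ffun I -> nat}] (range (incr i)) (incr i).
  by split=> [u _|u v _ _ /incr_inj//|_ [u _ <-]]; exists u.
transitivity (\esum_(u in range (incr i))
    (((u i)%:R * G u)%:E * P (counts @^-1` [set u])))%E.
  rewrite [RHS]esum_mkcond; apply: eq_esum => u _.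
  case: ifPn => // /negP ui; suff -> : u i = 0%N by rewrite !mul0r mul0e.
  case uiE : (u i) => [//|n]; case: ui; apply/mem_set.
  (* A vector with [u i] positive is the shift of the one with coordinate [i] lowered by one;
     truncated subtraction is exact there. *)
  exists [ffun j => (u j - (j == i))%N] => //; apply/ffunP => j; rewrite !ffunE.
  by rewrite subnK//; case: eqVneq => // ->; rewrite uiE.
rewrite (reindex_esum _ _ _ _ incr_bij); apply: eq_esum => u _.
rewrite !counts_pmf -!EFinM; congr EFin.
by rewrite mulrAC prod_pmf_incr mulrAC.
Qed.

Lemma has_meanP F : has_mean F <-> (mean (fun u => `|F u|)%R < +oo)%E.
Proof.
split=> [/integrableP[_]//|Foo]; apply/integrableP; split=> //.
exact: measurable_counts_comp.
Qed.

Lemma has_mean_norm F : has_mean F -> has_mean (fun u => `|F u|).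
Proof. exact: integrable_norm. Qed.

Lemma mean_fin_num F : has_mean F -> mean F \is a fin_num.
Proof. exact: integrable_fin_num. Qed.

Lemma has_mean_le F G : (forall u, `|F u| <= G u) -> has_mean G -> has_mean F.
Proof.
move=> FG hG; apply: le_integrable hG => //; first exact: measurable_counts_comp.
by move=> w _; rewrite /= lee_fin (le_trans (FG _))// ler_norm.
Qed.

Lemma has_meanD F G : has_mean F -> has_mean G -> has_mean (fun u => F u + G u).
Proof. exact: integrableD. Qed.

Lemma has_meanZ c F : has_mean F -> has_mean (fun u => c * F u).
Proof. exact: integrableZl. Qed.

Lemma has_mean_sum (J : finType) (F : J -> {ffun I -> nat} -> R) :
  (forall j, has_mean (F j)) -> has_mean (fun u => \sum_j F j u).
Proof.
move=> hF; rewrite /has_mean.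
under eq_fun do rewrite -sumEFin.
by apply: integrable_sum => // j _; exact: hF.
Qed.

Lemma has_mean_cst c : has_mean (fun=> c).
Proof. exact: finite_measure_integrable_cst. Qed.

Lemma meanD F G : has_mean F -> has_mean G ->
  mean (fun u => F u + G u) = (mean F + mean G)%E.
Proof. by move=> hF hG; rewrite /mean -integralD//; apply: eq_integral. Qed.

Lemma meanZ c F : has_mean F -> mean (fun u => c * F u) = (c%:E * mean F)%E.
Proof. by move=> hF; rewrite /mean -integralZl. Qed.

(** The nonnegative identity for [|G|] makes the two absolute means differ by the factor [mu i],
    which is positive and finite, so they are finite together. *)
Lemma has_mean_mul_coord i G :
  has_mean (fun u => (u i)%:R * G u) <-> has_mean (fun u => G (incr i u)).
Proof.
rewrite !has_meanP.
have -> : (fun u => `|(u i)%:R * G u|) = (fun u => (u i)%:R * `|G u|).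
  by apply/funext => u; rewrite normrM normr_nat.
rewrite ge0_mean_incr//; split=> [|Goo].
  by case: (mean _) => [r _||_]//; [rewrite ltry|rewrite gt0_muley ?lte_fin].
by rewrite lte_mul_pinfty// lee_fin ltW.
Qed.

(** The signed case follows from the nonnegative one applied to the positive and negative parts of
    [G]. *)
Lemma mean_incr i G : has_mean (fun u => G (incr i u)) ->
  mean (fun u => (u i)%:R * G u) = ((mu i)%:E * mean (fun u => G (incr i u)))%E.
Proof.
move=> hG.
pose Gp u := Num.max (G u) 0; pose Gn u := Num.max (- G u) 0.
have Gp0 u : 0 <= Gp u by rewrite le_max lexx orbT.
have Gn0 u : 0 <= Gn u by rewrite le_max lexx orbT.
have GE u : G u = Gp u + -1 * Gn u.
  by rewrite /Gp /Gn; case: (leP (G u) 0) => ?; case: (leP (- G u) 0) => ?; lra.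
have hGp : has_mean (fun u => Gp (incr i u)).
  apply: has_mean_le (has_mean_norm hG).
  by move=> u; rewrite ger0_norm// /Gp ge_max normr_ge0 ler_norm.
have hGn : has_mean (fun u => Gn (incr i u)).
  apply: has_mean_le (has_mean_norm hG).
  by move=> u; rewrite ger0_norm// /Gn ge_max normr_ge0 -normrN ler_norm.
have -> : (fun u => (u i)%:R * G u) =
    (fun u => (u i)%:R * Gp u + -1 * ((u i)%:R * Gn u)).
  by apply/funext => u; rewrite GE; ring.
under [in RHS]eq_fun do rewrite GE.
have hp := proj2 (has_mean_mul_coord i Gp) hGp.
have hn := proj2 (has_mean_mul_coord i Gn) hGn.
rewrite meanD// ?meanZ//; last exact: has_meanZ.
rewrite meanD// ?meanZ//; last exact: has_meanZ.
rewrite !ge0_mean_incr// [in RHS]muleDr//.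
  by rewrite [in LHS]muleCA.
by rewrite fin_num_adde_defr// mean_fin_num.
Qed.

(** Were the mean zero, [F] would vanish almost everywhere; as it vanishes nowhere, the whole space
    would be null, against total mass [1]. *)
Lemma mean_gt0 F : (forall u, 0 < F u) -> (0 < mean F)%E.
Proof.
move=> F0; rewrite lt_def; apply/andP; split; last first.
  by apply: integral_ge0 => w _; rewrite lee_fin ltW.
apply/eqP => mF0.
have [+ _] := ae_eq_integral_abs P measurableT (measurable_counts_comp F); case.
  by rewrite -mF0; apply: eq_integral => w _; rewrite /= ger0_norm// ltW.
move=> N [mN N0 NF]; have : P [set: T] = 0%E.
  apply: (@subset_measure0 _ _ _ P _ N) => // w _; apply: NF => /= /(_ Logic.I) [] /eqP.
  by rewrite gt_eqF.
by rewrite probability_setT => /eqP; rewrite onee_eq0.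
Qed.

(** Equality of means is expressed as a difference being null. With integrability built in, such
    differences are closed under linear combinations, so replacements can simply be added up. *)
Definition null_mean F : Prop := has_mean F /\ mean F = 0%E.

Lemma null_meanD F G : null_mean F -> null_mean G ->
  null_mean (fun u => F u + G u).
Proof.
move=> [hF F0] [hG G0]; split; first exact: has_meanD.
by rewrite meanD// F0 G0 adde0.
Qed.

Lemma null_meanZ c F : null_mean F -> null_mean (fun u => c * F u).
Proof.
move=> [hF F0]; split; first exact: has_meanZ.
by rewrite meanZ// F0 mule0.
Qed.

Lemma null_mean_sum (J : finType) (F : J -> {ffun I -> nat} -> R) :
  (forall j, null_mean (F j)) -> null_mean (fun u => \sum_j F j u).
Proof.
move=> hF; split; first by apply: has_mean_sum => j; have [] := hF j.
rewrite /mean; under eq_integral do rewrite -sumEFin.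
rewrite integral_sum//; last by move=> j; have [] := hF j.
by rewrite big1// => j _; have [_] := hF j.
Qed.

Lemma null_mean_incr i G G' : (forall u, G (incr i u) = G' u) ->
  has_mean (fun u => (u i)%:R * G u) ->
  null_mean (fun u => (u i)%:R * G u - mu i * G' u).
Proof.
move=> /funext <- h; have h' := proj1 (has_mean_mul_coord i G) h.
have -> : (fun u => (u i)%:R * G u - mu i * G (incr i u)) =
    (fun u => (u i)%:R * G u + - mu i * G (incr i u)).
  by apply/funext => u; rewrite mulNr.
split; first by apply: has_meanD => //; exact: has_meanZ.
rewrite meanD//; last exact: has_meanZ.
by rewrite meanZ// mean_incr// EFinN mulNe subee// fin_numM// mean_fin_num.
Qed.

(** The dominating function for the later integrability claims. Stein's identity lowers the degree:
    the total reduces to constants, and its square, after one shift, to [1] plus the total. *)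
Lemma has_mean_total_sqr : has_mean (fun u => (1 + \sum_i (u i)%:R) ^+ 2).
Proof.
have total_incr i u : \sum_j (incr i u j)%:R = 1 + \sum_j (u j)%:R :> R.
  under eq_bigr do rewrite ffunE natrD.
  rewrite big_split addrC; congr +%R.
  by rewrite (bigD1 i)//= eqxx big1 ?addr0// => j /negbTE ->.
have h1 : has_mean (fun u => \sum_i (u i)%:R).
  apply: has_mean_sum => i.
  have := proj2 (has_mean_mul_coord i (fun=> 1)) (has_mean_cst 1).
  by congr has_mean; apply/funext => u; rewrite mulr1.
have h2 : has_mean (fun u => \sum_i (u i)%:R * \sum_j (u j)%:R).
  apply: has_mean_sum => i.
  apply/(has_mean_mul_coord i (fun u => \sum_j (u j)%:R)).
  under [X in has_mean X]eq_fun do rewrite total_incr.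
  exact: has_meanD (has_mean_cst 1) h1.
have := has_meanD (has_meanD (has_mean_cst 1) (has_meanZ 2 h1)) h2.
congr has_mean; apply/funext => u; rewrite -mulr_suml; ring.
Qed.

End poisson_family.

(** * Positivity of the function of the total that measures the improvement *)

Section shrinkage.
Context (R : realType) (m : nat).
Hypothesis m_ge2 : (2 <= m)%N.

Definition shrink (j : nat) : R := (j%:R + m%:R - 1)^-1.

(* At [j = 0] the junk value of [shrink j.-1] is multiplied by [0]. *)
Definition risk_gap (j : nat) : R :=
  (3 * (j%:R + 1) ^+ 2 * shrink j.+1 - (6 * j%:R ^+ 2 + j%:R) * shrink j
   + 3 * j%:R * (j%:R - 1) * shrink j.-1) / 4.

Lemma m_real_ge2 : 2 <= m%:R :> R.
Proof. by rewrite (ler_nat R 2 m). Qed.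

Lemma shrink_bounds j : [/\ 0 <= shrink j, shrink j <= 1, j%:R * shrink j <= 1
  & shrink j * (j%:R + m%:R - 1) = 1].
Proof.
have m2 := m_real_ge2; have j0 : 0 <= j%:R :> R by [].
have den : 1 <= j%:R + m%:R - 1 :> R by lra.
have den0 : 0 < j%:R + m%:R - 1 :> R by lra.
rewrite /shrink; split.
- by rewrite invr_ge0 ltW.
- by rewrite invf_le1.
- by rewrite ler_pdivrMr// mul1r; lra.
- by rewrite mulVf// gt_eqF.
Qed.

(** At [j = 0] only the positive multiple of [shrink 1] survives. For [j = p.+1], put x = p and t =
    m - 2; over the common denominator the numerator is a polynomial in x, t >= 0 with positive
    coefficients only. *)
Lemma risk_gap_gt0 j : 0 < risk_gap j.
Proof.
have m2 := m_real_ge2; rewrite /risk_gap.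
case: j => [|p] /=.
  have [s0 _ _ sE] := shrink_bounds 1.
  have s1 : shrink 1 != 0 by apply/eqP => s1; move: sE; rewrite s1; lra.
  have : 0 < shrink 1 by rewrite lt_def s1.
  by rewrite !mulr0 !mul0r; lra.
have p0 : 0 <= p%:R :> R by [].
rewrite /shrink -![p.+2%:R]natr1 -![p.+1%:R]natr1; move: (p%:R : R) p0 => x x0.
have [t t0 ->] : exists2 t : R, 0 <= t & m%:R = 2 + t.
  by exists (m%:R - 2); lra.
set e := (X in 0 < X).
have -> : e = ((9 + 8 * x + 5 * t + 2 * x ^+ 2 + 2 * t * x) * (1 + x + t)
    - 6 * (1 + x) * (1 + t)) / (4 * (x + t + 1) * (x + t + 2) * (x + t + 3)).
  rewrite /e; field; rewrite ?gt_eqF//; lra.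
rewrite divr_gt0//; last by rewrite !mulr_gt0//; lra.
have xt : 0 <= t * x by rewrite mulr_ge0.
have xx : 0 <= x ^+ 2 by rewrite exprn_ge0.
have tt : 0 <= t ^+ 2 by rewrite exprn_ge0.
(* The expanded numerator is 3 + 11x + 8t + 8x^2 + 7tx + 5t^2 + 2(x^2 + tx)(1 + x + t). *)
have : 0 <= x ^+ 2 * (1 + x + t) by rewrite mulr_ge0//; lra.
have : 0 <= t * x * (1 + x + t) by rewrite mulr_ge0//; lra.
by nra.
Qed.

End shrinkage.

(** * Reduction of the loss difference to a function of the total *)

Section risk_difference.
Context (R : realType) (m : nat) (m_ge2 : (2 <= m)%N).
Context d (T : measurableType d) (P : 'rV[R]_m -> probability T R).
Context (X : 'I_m -> {mfun T >-> nat}) (Y : {mfun T >-> nat}).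
Context (l : 'rV[R]_m) (l_gt0 : positive_vector l).

Hypothesis X_poisson : forall i, has_poisson_law (P l) (X i) (l 0 i).
Hypothesis Y_poisson : has_poisson_law (P l) Y (\sum_(i < m) l 0 i).
Hypothesis XY_indep : independent_RVs (P l) (joint_family X Y).

Implicit Types u : {ffun option 'I_m -> nat}.

Let Lambda : R := \sum_(i < m) l 0 i.
Let mu (i : option 'I_m) : R := if i is Some j then l 0 j else Lambda.
Let xs u (i : 'I_m) : nat := u (Some i).
Let tot u : nat := total_count (xs u).
Let x u i : R := (xs u i)%:R.
Let n u : R := (tot u)%:R.
Let y u : R := (u None)%:R.
Let c := @shrink R m.
Local Notation E := (mean (P l) (joint_family X Y)).
Local Notation hm := (has_mean (P l) (joint_family X Y)).
Local Notation nm := (null_mean (P l) (joint_family X Y)).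
Let loss_X u : R := loss (@lambda_hat_X R m (xs u) (u None)) l.
Let loss_XY u : R := loss (@lambda_hat_XY R m (xs u) (u None)) l.

Let XY_poisson i : has_poisson_law (P l) (joint_family X Y i) (mu i).
Proof. by case: i => [i|]; [exact: X_poisson|exact: Y_poisson]. Qed.

Let mu_gt0 i : 0 < mu i.
Proof.
case: i => [i|] /=; first exact: l_gt0.
rewrite /Lambda (bigD1 (Ordinal (ltnW m_ge2)))//= ltr_wpDr//.
by apply: sumr_ge0 => i _; exact: ltW.
Qed.

Let sum_x u : \sum_i x u i = n u.
Proof. by rewrite /n /tot /total_count natr_sum. Qed.

Let x_bounds u i : 0 <= x u i <= n u.
Proof.
rewrite ler0n -sum_x (bigD1 i)//= lerDl sumr_ge0// => j _; exact: ler0n.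
Qed.

Let has_mean_quad F C :
  (forall u, `|F u| <= C * (1 + n u + y u) ^+ 2) -> hm F.
Proof.
move=> FC; apply: (has_mean_le FC); apply: has_meanZ.
have := has_mean_total_sqr mu_gt0 XY_poisson XY_indep.
congr has_mean; apply/funext => u; congr (_ ^+ _).
(* The total over all coordinates splits into the [None] term [y u] and the [Some] terms, which sum
   to [n u]. *)
rewrite (bigD1 None)//= (reindex_omap Some id); last by case.
rewrite -sum_x addrAC addrA; congr (_ + _ + _).
by apply: eq_bigl => i; rewrite eqxx.
Qed.

Let tot_incr_some i u : tot (incr (Some i) u) = (tot u).+1.
Proof.
rewrite /tot /total_count /xs; under eq_bigr do rewrite ffunE.
rewrite big_split/= -addn1; congr addn.
by rewrite (bigD1 i)//= eqxx big1// => j /negbTE; rewrite (inj_eq Some_inj) => ->.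
Qed.

Let y_ge0 u : 0 <= y u. Proof. exact: ler0n. Qed.

Let n_ge0 u : 0 <= n u. Proof. exact: ler0n. Qed.

Let null_x i G G' C : (forall u, G (incr (Some i) u) = G' u) ->
  (forall u, `|x u i * G u| <= C * (1 + n u + y u) ^+ 2) ->
  nm (fun u => x u i * G u - l 0 i * G' u).
Proof.
move=> GG' GC; apply: (null_mean_incr mu_gt0 XY_poisson XY_indep GG').
exact: has_mean_quad GC.
Qed.

Let null_y G G' C : (forall u, G (incr None u) = G' u) ->
  (forall u, `|y u * G u| <= C * (1 + n u + y u) ^+ 2) ->
  nm (fun u => y u * G u - Lambda * G' u).
Proof.
move=> GG' GC; apply: (null_mean_incr mu_gt0 XY_poisson XY_indep GG').
exact: has_mean_quad GC.
Qed.

Let linear_bound u a g C : 0 <= a <= n u + y u -> `|g| <= C ->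
  `|a * g| <= C * (1 + n u + y u) ^+ 2.
Proof.
move=> /andP[a0 an] gC; rewrite normrM ger0_norm// mulrC.
apply: ler_pM => //; rewrite (le_trans an)//.
by have := n_ge0 u; have := y_ge0 u; nra.
Qed.

(** Stein's identity for the total N of X, obtained by summing the identities of the coordinates:
    each shift raises N by one, and the means add up to Lambda. *)
Let null_total (h : nat -> R) C : (forall j, `|h j| <= C) ->
  nm (fun u => n u * h (tot u) - Lambda * h (tot u).+1).
Proof.
move=> hC.
have : nm (fun u => \sum_i (x u i * h (tot u) - l 0 i * h (tot u).+1)).
  apply: null_mean_sum => i.
  apply: (@null_x i (fun u => h (tot u)) _ C) => u; first by rewrite tot_incr_some.
  apply: linear_bound => //; have /andP[-> xn] /= := x_bounds u i.
  by rewrite (le_trans xn)// lerDl y_ge0.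
congr null_mean; apply/funext => u.
by rewrite sumrB -!mulr_suml sum_x.
Qed.

Let tot_incr_none u : tot (incr None u) = tot u.
Proof. by apply: eq_bigr => i _; rewrite /xs ffunE addn0. Qed.

(** A shift of Y leaves the total of X unchanged, so [h] keeps its argument. *)
Let null_y_total (h : nat -> R) C : (forall j, `|h j| <= C) ->
  nm (fun u => y u * h (tot u) - Lambda * h (tot u)).
Proof.
move=> hC; apply: (@null_y (fun u => h (tot u)) _ C) => u.
  by rewrite tot_incr_none.
by apply: linear_bound => //; rewrite y_ge0 lerDr n_ge0.
Qed.

Let c_bounds := @shrink_bounds R m m_ge2.

Let jc_bounds j : 0 <= j%:R * c j <= 1.
Proof. by have [c0 _ -> _] := c_bounds j; rewrite mulr_ge0. Qed.

Let pred_c_bounds j : `|(j%:R - 1) * c j.-1| <= 1.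
Proof.
case: j => [|j]/=.
  (* At [j = 0] the truncated predecessor is [0] and the value is [- c 0]. *)
  by have [c0 c1 _ _] := c_bounds 0; rewrite sub0r mulN1r normrN ger0_norm.
rewrite -natr1 addrK; have /andP[? ?] := jc_bounds j; by rewrite ger0_norm.
Qed.

Let null_quadratic :
  nm (fun u => y u * (y u * c (tot u).+1) - Lambda * ((y u + 1) * c (tot u).+1)).
Proof.
apply: (@null_y (fun u => y u * c (tot u).+1) _ 1) => u.
  by rewrite tot_incr_none /y ffunE eqxx natrD.
have [c0 c1 _ _] := c_bounds (tot u).+1.
have y0 := y_ge0 u; have n0 := n_ge0 u.
rewrite ger0_norm ?mulr_ge0// mul1r mulrA -expr2.
rewrite (le_trans (ler_piMr _ c1)) ?exprn_ge0//.
by rewrite lerXn2r ?nnegrE//; lra.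
Qed.

(** The coefficient (n c)^2 - ((n + y) c / 2)^2 of the sum of x_i^2 / lambda_i in the loss
    difference, factored as a difference of squares. *)
Let q u : R := (n u - y u) * (3 * n u + y u) / 4 * c (tot u) ^+ 2.

Let null_square i :
  nm (fun u => x u i * (x u i * q u) - l 0 i * ((x u i + 1) *
    ((n u + 1 - y u) * (3 * (n u + 1) + y u) / 4 * c (tot u).+1 ^+ 2))).
Proof.
apply: (@null_x i (fun u => x u i * q u) _ 1) => u.
  rewrite /q tot_incr_some /n /x /y /xs tot_incr_some !ffunE eqxx/= addn0 addn1.
  by rewrite -!natr1.
have [c0 c1 nc _] := c_bounds (tot u).
have y0 := y_ge0 u; have n0 := n_ge0 u; have /andP[x0 xn] := x_bounds u i.
have xc : x u i * c (tot u) <= 1.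
  by rewrite (le_trans _ nc)// ler_wpM2r.
have xc0 : 0 <= x u i * c (tot u) by rewrite mulr_ge0.
(* The factor [c ^+ 2] in [q] absorbs [x ^+ 2], which leaves quadratic growth. *)
have -> : x u i * (x u i * q u) = (x u i * c (tot u)) ^+ 2 *
    ((n u - y u) * (3 * n u + y u) / 4) by rewrite /q; ring.
rewrite normrM ger0_norm ?exprn_ge0//.
apply: ler_pM; rewrite ?exprn_ge0//; first by rewrite expr_le1.
by rewrite ler_norml; apply/andP; split; nra.
Qed.

Let loss_scaled (t : R) u :
  \sum_i (t * x u i - l 0 i) ^+ 2 / l 0 i =
  t ^+ 2 * (\sum_i x u i ^+ 2 / l 0 i) - 2 * t * n u + Lambda.
Proof.
rewrite -sum_x !mulr_sumr -sumrB -big_split; apply: eq_bigr => i _ /=.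
by field; rewrite gt_eqF// l_gt0.
Qed.

Let loss_XE u : loss_X u =
  \sum_i (n u * c (tot u) * x u i - l 0 i) ^+ 2 / l 0 i.
Proof. by apply: eq_bigr => i _; rewrite mxE -[in RHS]mulrA [c _ * _]mulrC. Qed.

Let loss_XYE u : loss_XY u =
  \sum_i ((n u + y u) / 2 * c (tot u) * x u i - l 0 i) ^+ 2 / l 0 i.
Proof. by apply: eq_bigr => i _; rewrite mxE -[in RHS]mulrA [c _ * _]mulrC. Qed.

Let has_mean_loss (a : {ffun option 'I_m -> nat} -> R) :
  (forall u, 0 <= a u <= n u + y u) ->
  hm (fun u => \sum_i (a u * c (tot u) * x u i - l 0 i) ^+ 2 / l 0 i).
Proof.
move=> a_bounds; apply: has_mean_sum => i.
(* The constant comes from (t - l)^2 <= 2 t^2 + 2 l^2 <= 2 (1 + l^2) s^2, with t <= s and s = 1 + n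
   + y >= 1. *)
apply: (@has_mean_quad _ (2 * (1 + l 0 i ^+ 2) / l 0 i)) => u.
have l0 := l_gt0 i; have /andP[a0 an] := a_bounds u.
have [c0 c1 nc _] := c_bounds (tot u); have /andP[x0 xn] := x_bounds u i.
have cx0 : 0 <= c (tot u) * x u i by rewrite mulr_ge0.
have cx1 : c (tot u) * x u i <= 1.
  by rewrite mulrC (le_trans _ nc)// ler_wpM2r.
rewrite ger0_norm; last by rewrite divr_ge0 ?sqr_ge0// ltW.
rewrite [leRHS]mulrAC ler_pM2r ?invr_gt0// -[a u * _ * _]mulrA.
have : 0 <= a u * (c (tot u) * x u i) by rewrite mulr_ge0.
have : a u * (c (tot u) * x u i) <= n u + y u.
  by rewrite (le_trans _ an)// ler_piMr.
have := n_ge0 u; have := y_ge0 u.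
set t := a u * _; set s := 1 + n u + y u => y0 n0 ts t0.
have : t ^+ 2 <= s ^+ 2 by rewrite lerXn2r ?nnegrE /s; lra.
have : 1 <= s ^+ 2 by rewrite exprn_ege1// /s; lra.
have := sqr_ge0 (t + l 0 i); have := sqr_ge0 (l 0 i).
by nra.
Qed.

Let has_mean_loss_X : hm loss_X.
Proof.
rewrite (funext loss_XE).
by apply: has_mean_loss => u; rewrite n_ge0 lerDl y_ge0.
Qed.

Let has_mean_loss_XY : hm loss_XY.
Proof.
rewrite (funext loss_XYE).
by apply: has_mean_loss => u; have := y_ge0 u; have := n_ge0 u; lra.
Qed.

(* The linear and quadratic terms in Y reduce through
     y^2 c1 ~ Lambda (y + 1) c1, Lambda y c1 ~ Lambda^2 c1 ~ Lambda n c
            ~ n (n - 1) c(n - 1) and Lambda c1 ~ n c,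
   where c = c(n), c1 = c(n + 1) and ~ is equality of means. *)
Let null_loss_difference :
  nm (fun u => loss_X u
    - loss_XY u - risk_gap R m (tot u)).
Proof.
(* Once [nullS] has removed the squares, [h (tot u).+1] is the coefficient of the part linear in Y:
   n c(n) from the cross term and - (n + 1) c(n + 1) / 2 from the shifted [q]. The index is chosen
   so that [null_total] then turns Lambda h(n + 1) into n h(n). *)
pose h j := (j%:R - 1) * c j.-1 - j%:R * c j / 2.
have hN j : `|h j| <= 2.
  have := pred_c_bounds j; have /andP[] := jc_bounds j; rewrite !ler_norml /h; lra.
have h'N j : `|h j.+1| <= 2 by [].
have c1N j : `|c j.+1| <= 1 by have [? ? _ _] := c_bounds j.+1; rewrite ger0_norm.
have cN j : `|c j| <= 1 by have [? ? _ _] := c_bounds j; rewrite ger0_norm.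
have nullS := null_mean_sum (fun i => null_meanZ (l 0 i)^-1 (null_square i)).
have nullF := null_y_total h'N.
have nullG := null_meanZ (-1) (null_total hN).
have nullB := null_meanZ (- 4^-1) null_quadratic.
have nullC := null_meanZ (- Lambda / 4) (null_y_total c1N).
(* After [nullB] and [nullC] the term - y^2 c1 / 4 has become - Lambda (Lambda + 1) c1 / 4. This
   step makes it - (Lambda + 1) n c / 4, and [nullE] removes the remaining Lambda. *)
have nullD := null_meanZ ((Lambda + 1) / 4) (null_total cN).
have nullE := null_meanZ (4^-1) (null_total pred_c_bounds).
have := null_meanD nullS (null_meanD nullF (null_meanD nullG (null_meanD nullB
  (* What remains is that the seven null functions add up pointwise to the claimed one. *)
  (null_meanD nullC (null_meanD nullD nullE))))).
congr null_mean; apply/funext => u.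
rewrite loss_XE loss_XYE !loss_scaled /risk_gap /h /= -/c -/(n u).
have -> : (tot u).+1%:R = n u + 1 by rewrite -natr1.
set S := \sum_i x u i ^+ 2 / l 0 i.
have -> : \sum_i (l 0 i)^-1 * (x u i * (x u i * q u) - l 0 i * ((x u i + 1) *
    ((n u + 1 - y u) * (3 * (n u + 1) + y u) / 4 * c (tot u).+1 ^+ 2))) =
    q u * S - (n u + 1 - y u) * (3 * (n u + 1) + y u) / 4 * c (tot u).+1.
  (* The sum of the x_i + 1 is n + m, exactly the denominator of c(n + 1), so one factor of the
     square cancels. *)
  have cE : c (tot u).+1 = c (tot u).+1 ^+ 2 * \sum_i (x u i + 1).
    have [_ _ _] := c_bounds (tot u).+1.
    rewrite big_split sum_x sumr_const card_ord -natr1 addrAC addrK -/(n u).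
    by rewrite expr2 -mulrA => ->; rewrite mulr1.
  rewrite [X in _ - _ * X]cE.
  rewrite /S !mulr_sumr -sumrB; apply: eq_bigr => i _.
  by field; rewrite gt_eqF// l_gt0.
by rewrite /q; field.
Qed.

Let riskE (delta : estimator R m) :
  risk P X Y delta l = E (fun u => loss (delta (xs u) (u None)) l).
Proof.
rewrite /risk unlock; apply: eq_integral => w _; rewrite /xs ffunE.
by congr (loss (delta _ _) _)%:E; apply/funext => i; rewrite ffunE.
Qed.

(** The loss of the first estimator is that of the second plus the gap plus a null function. The gap
    has positive mean, and finiteness of the second risk keeps the inequality strict. *)
Lemma risk_lt :
  (risk P X Y (@lambda_hat_XY R m) l < risk P X Y (@lambda_hat_X R m) l)%E.
Proof.
rewrite !riskE -/loss_X -/loss_XY.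
have [hD D0] := null_loss_difference.
(* The gap is a linear combination of the two losses and the null function, hence integrable. *)
have hG : hm (fun u => risk_gap R m (tot u)).
  have := has_meanD (has_meanD has_mean_loss_X (has_meanZ (-1) has_mean_loss_XY))
    (has_meanZ (-1) hD).
  by congr has_mean; apply/funext => u; ring.
have LE : loss_X =
    (fun u => loss_XY u + risk_gap R m (tot u) +
      (loss_X u -
       loss_XY u - risk_gap R m (tot u))).
  by apply/funext => u; ring.
rewrite {}LE meanD//; last exact: has_meanD.
rewrite D0 adde0 meanD//.
rewrite lteDl ?mean_gt0// ?mean_fin_num// => u.
exact: risk_gap_gt0.
Qed.

End risk_difference.


Theorem theorem2p2 (R : realType) (m : nat) (hm : (2 <= m)%N)
    (disp : measure_display) (T : measurableType disp)
    (P : 'rV[R]_m -> probability T R)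
    (X : 'I_m -> {mfun T >-> nat}) (Y : {mfun T >-> nat})
    (hX : forall l : 'rV[R]_m, positive_vector l ->
       forall i : 'I_m, has_poisson_law (P l) (X i) (l 0 i))
    (hY : forall l : 'rV[R]_m, positive_vector l ->
       has_poisson_law (P l) Y (\sum_(i < m) l 0 i))
    (hind : forall l : 'rV[R]_m, positive_vector l ->
       independent_RVs (P l) (joint_family X Y)) :
  estimator_dominated_by P X Y (@lambda_hat_X R m) (@lambda_hat_XY R m).
Proof.
have risk_lt_pos l : positive_vector l ->
    (risk P X Y (@lambda_hat_XY R m) l < risk P X Y (@lambda_hat_X R m) l)%E.
  by move=> l_gt0; apply: risk_lt => //; [exact: hX|exact: hY|exact: hind].
split=> [l /risk_lt_pos/ltW//|].
(* Strictness holds at every positive vector, so any one serves as witness. *)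
exists (const_mx 1); have one_gt0 : positive_vector (const_mx 1 : 'rV[R]_m).
  by move=> i; rewrite mxE.
by split=> //; exact: risk_lt_pos.
Qed.
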